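(* For any family of Boolean functions $F = \{f_n\}_{n \in \mathbb{N}}$ and any $\Delta\colon \mathbb{N} \to \mathbb{N}$, $\mathcal{L}^{\mathrm{LNBP}_{\Delta(n)}}_F(n) \in O\bigl(\Gamma(n, \Delta(n))\bigr)$. In particular, $\mathcal{L}^{\mathrm{BP}}_F(n) \in O\bigl(\frac{n^2}{\log^2_2 n}\bigr)$.
   Context: For an $n$-ary Boolean function $f$ and $V \subseteq [n]$, $r_V(f)$ denotes the number of distinct subfunctions of $f$ on $V$ obtained by fixing the variables outside $V$. A Nečiporuk function for a complexity measure $\mathbf{M}$ is a non-decreasing $b\colon \mathbb{N}_{>0}\to\mathbb{N}$ such that for every $n$, every $n$-ary $f$ and every partition $V_1,\dots,V_p$ of $[n]$, $\mathbf{M}(f) \ge \sum_{i=1}^p b(r_{V_i}(f))$; $\mathcal{N}_{\mathbf{M}}$ is the set of these, and $\mathcal{L}^{\mathbf{M}}_F(n) = \max\{\sum_{i=1}^p b(r_{V_i}(f_n)) \mid b \in \mathcal{N}_{\mathbf{M}},\ V_1,\dots,V_p \text{ partition of } [n]\}$. $\mathrm{BP}(f)$ is the minimum number of non-sink vertices of a deterministic branching program computing $f$. A $\delta$-limited nondeterministic branching program for $f\colon\{0,1\}^n\to\{0,1\}$ is a deterministic branching program computing some $f'$ on $n+\delta$ variables with $f(a) = \bigvee_{b \in \{0,1\}^\delta} f'(a,b)$; $\mathrm{LNBP}_\delta(f)$ is the minimum number of non-sink vertices of such a program. $\Gamma\colon[2,+\infty)\times\mathbb{N}_{>0}\to\mathbb{R}$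 is defined by $\Gamma(x,\delta) = \max\bigl\{\frac{x^2}{2^\delta(\log_2 x - \delta)\log_2 x}, x\bigr\}$ if $2^{\delta+1} \le x$, and $\Gamma(x,\delta) = x$ otherwise. *)

(* Defs.v *)
From HB Require Import structures.
From mathcomp Require Import all_boot all_order all_algebra.
From mathcomp Require Import boolp classical_sets filter reals topology normedtype landau exp.
(* Re-imported last: [partition], [setT] below are those of finite sets. *)
From mathcomp Require Import finset.

Set Implicit Arguments.
Unset Strict Implicit.
Unset Printing Implicit Defensive.

Import Order.TTheory GRing.Theory Num.Theory.

Local Open Scope nat_scope.

Notation assignment n := {ffun 'I_n -> bool}.
Notation boolfun n := {ffun assignment n -> bool}.
Notation complexity_measure := (forall n : nat, boolfun n -> nat).

(* The subfunction of [f] on [V] obtained by fixing the variables outside [V]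
   according to [a]; the values of [a] on [V] are irrelevant. *)
Definition subfun n (f : boolfun n) (V : {set 'I_n}) (a : assignment n) :
    {ffun {ffun {i : 'I_n | i \in V} -> bool} -> bool} :=
  [ffun x : {ffun {i : 'I_n | i \in V} -> bool} =>
     f [ffun i => if insub i is Some j then x j else a i]].

Definition nb_subfun n (V : {set 'I_n}) (f : boolfun n) : nat :=
  #|[set subfun f V a | a : assignment n]|.

Definition neciporuk_sum (b : nat -> nat) n (f : boolfun n)
    (P : {set {set 'I_n}}) : nat :=
  \sum_(V in P) b (nb_subfun V f).

(* A function on the positive integers is represented by [b : nat -> nat] whose
   value at 0 is unconstrained; it is never used since [0 < nb_subfun V f]. *)
Definition neciporuk_fun (M : complexity_measure) (b : nat -> nat) : Prop :=
  (forall r s, 0 < r -> r <= s -> b r <= b s) /\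
  (forall n (f : boolfun n) (P : {set {set 'I_n}}),
     partition P [set: 'I_n]%SET -> neciporuk_sum b f P <= M n f).

Definition neciporuk_value (M : complexity_measure) (F : forall n, boolfun n)
    (n k : nat) : Prop :=
  exists (b : nat -> nat) (P : {set {set 'I_n}}),
    [/\ neciporuk_fun M b, partition P [set: 'I_n]%SET
      & k = neciporuk_sum b (F n) P].

Lemma neciporuk_value_ex M F n : exists k, `[< neciporuk_value M F n k >].
Proof.
exists 0; apply/asboolP.
exists (fun=> 0), (preim_partition id [set: 'I_n]%SET); split.
- by split=> // m f P _; rewrite /neciporuk_sum big1.
- exact: preim_partitionP.
- by rewrite /neciporuk_sum big1.
Qed.

Lemma neciporuk_value_le M F n k :
  `[< neciporuk_value M F n k >] -> k <= M n (F n).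
Proof. by move=> /asboolP[b [P [[_ bM] partP ->]]]; exact: bM. Qed.

Definition neciporuk_bound (M : complexity_measure) (F : forall n, boolfun n)
    (n : nat) : nat :=
  ex_maxn (neciporuk_value_ex M F n) (@neciporuk_value_le M F n).

(* [bp_node] is the type of the non-sink vertices; the sinks are [inr false] and
   [inr true]. *)
Record branching_program (n : nat) := BranchingProgram {
  bp_node : finType;
  bp_var : bp_node -> 'I_n;
  bp_succ : bp_node -> bool -> bp_node + bool;
  bp_source : bp_node + bool;
  bp_edge : rel bp_node := fun u v => [exists c, bp_succ u c == inl v];
  bp_acyclic : forall u v, bp_edge u v -> ~~ connect bp_edge v u
}.

Definition bp_size n (B : branching_program n) : nat := #|bp_node B|.

Definition bp_step n (B : branching_program n) (x : assignment n)
    (u : bp_node B + bool) : bp_node B + bool :=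
  match u with
  | inl v => bp_succ v (x (bp_var v))
  | inr c => inr c
  end.

Definition bp_computes n (B : branching_program n) (f : boolfun n) : Prop :=
  forall x, fconnect (bp_step x) (bp_source B) (inr (f x)).

Definition has_bp n (f : boolfun n) (s : nat) : Prop :=
  exists B : branching_program n, bp_computes B f /\ bp_size B = s.

(* A (redundant) decision tree querying the variables in order; a vertex stores
   the answers received so far and the next variable to be queried. *)
Section DecisionTree.
Variables (n : nat) (f : boolfun n).

Let node := (assignment n * 'I_n)%type.

Let goto (k : nat) (y : assignment n) : node + bool :=
  if insub k is Some i then inl (y, i) else inr (f y).

Let succ (u : node) (c : bool) : node + bool :=
  goto u.2.+1 [ffun j => if j == u.2 then c else u.1 j].

Let edge : rel node := fun u v => [exists c, succ u c == inl v].

Let edge_lt u v : edge u v -> u.2 < v.2.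
Proof.
move=> /existsP[c /eqP]; rewrite /succ /goto.
by case: insubP => // i _ ei [<-] /=; rewrite ei.
Qed.

Let connect_le u v : connect edge u v -> u.2 <= v.2.
Proof.
move=> /connectP[p]; elim: p u => [|w p IHp] u /=; first by move=> _ ->.
by move=> /andP[/edge_lt uw pw] /(IHp _ pw); exact/leq_trans/ltnW.
Qed.

Let acyclic u v : edge u v -> ~~ connect edge v u.
Proof.
by move=> /edge_lt uv; apply/negP => /connect_le; rewrite leqNgt uv.
Qed.

Let tree : branching_program n :=
  @BranchingProgram n node snd succ (goto 0 [ffun=> false]) acyclic.

Let prefix k (x : assignment n) : assignment n := [ffun j : 'I_n => (j < k) && x j].

Let tree_iter x k : k <= n ->
  iter k (@bp_step n tree x) (bp_source tree) = goto k (prefix k x).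
Proof.
elim: k => [_|k IHk ltkn] /=.
  by congr goto; apply/ffunP => j; rewrite !ffunE.
rewrite IHk 1?ltnW // {1}/goto insubT /= /succ /=; congr goto.
apply/ffunP => j; rewrite !ffunE -val_eqE /= ltnS.
by case: ltngtP => //= jk; congr (x _); exact/val_inj.
Qed.

Lemma has_bp_ex : exists s, has_bp f s.
Proof.
exists (bp_size tree), tree; split=> // x.
have -> : inr (f x) = iter n (@bp_step n tree x) (bp_source tree).
  rewrite tree_iter // /goto insubF ?ltnn //; congr (inr (f _)).
  by apply/ffunP => j; rewrite ffunE ltn_ord.
exact: fconnect_iter.
Qed.

End DecisionTree.

Lemma has_bp_exb n (f : boolfun n) : exists s, `[< has_bp f s >].
Proof. by have [s fs] := has_bp_ex f; exists s; apply/asboolP. Qed.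

Definition BP : complexity_measure := fun n f => ex_minn (has_bp_exb f).

Definition cat_assignment n d (a : assignment n) (b : assignment d) :
    assignment (n + d) :=
  [ffun i => match split i with inl j => a j | inr k => b k end].

Definition has_lnbp d n (f : boolfun n) (s : nat) : Prop :=
  exists f' : boolfun (n + d),
    (forall a, f a = [exists b, f' (cat_assignment a b)]) /\ has_bp f' s.

Lemma has_lnbp_exb d n (f : boolfun n) : exists s, `[< has_lnbp d f s >].
Proof.
pose f' : boolfun (n + d) := [ffun x : assignment (n + d) => f [ffun i => x (lshift d i)]].
have [s f's] := has_bp_ex f'; exists s; apply/asboolP; exists f'; split=> // a.
have f'E b : f' (cat_assignment a b) = f a.
  rewrite ffunE; congr (f _); apply/ffunP => i; rewrite !ffunE.
  by rewrite (unsplitK (inl i)).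
apply/idP/existsP => [fa|[b]]; last by rewrite f'E.
by exists [ffun=> false]; rewrite f'E.
Qed.

Definition LNBP (d : nat) : complexity_measure :=
  fun n f => ex_minn (has_lnbp_exb d f).

Local Open Scope ring_scope.

Definition log2 (R : realType) (x : R) : R := ln x / ln 2.

(* Only meaningful for [2 <= x]. The case [d = 0] is given by the same formula. *)
Definition Gamma (R : realType) (x : R) (d : nat) : R :=
  if 2 ^+ d.+1 <= x
  then Num.max (x ^+ 2 / (2 ^+ d * (log2 x - d%:R) * log2 x)) x
  else x.

(* Main.v *)
(** For fixed [a <= d], [K], [L], take an indirect storage access function whose
table has [2 ^ a * K * L] cells, addressed by any one of [p] blocks of variables
(an address is [a] bits, a row and a column); which block is to be used is given
by further variables.  Each block sees all the [2 ^ (2 ^ a * K * L)] tables as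
distinct subfunctions.  A program guesses the [a] bits, checks them against the
selected block, finds the row, reads the table and keeps only the [L] bits of
the selected row, forgets everything else, finds the selected block again, and
finally finds the column.  Its size is [p * (1 + 3 a + K + 2 ^ L * (1 + L))],
plus the cost of reading the table, which does not depend on [p].  Letting [p]
grow, every Neciporuk function [b] satisfies
[b (2 ^ (2 ^ a * K * L)) <= 1 + 3 a + K + 2 ^ L * (1 + L)].

A set [V] of [v] variables among [n] has at most [2 ^ minn (2 ^ v) n]
subfunctions.  Choosing [a], [K], [L] according to [v] (for [v] at least half of
[log2 n]: [a = d], [K * L] about [2 ^ m] and [L] about [m / 4], where
[m = log2 n - d]) bounds the contribution of [V] by a constant times
[v * (1 + n / (2 ^ d * (log2 n - d) * log2 n))], and the [v]'s add up to [n]. *)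

Require Import Defs.
From mathcomp Require Import all_boot all_order all_algebra.
From mathcomp Require Import boolp classical_sets filter reals topology normedtype landau exp.
From mathcomp Require Import finset lra zify.
Import numFieldNormedType.Exports.

Set Implicit Arguments.
Unset Strict Implicit.
Unset Printing Implicit Defensive.

Local Open Scope nat_scope.

(** * Branching programs from a rank and an invariant *)

(** The rank drops along every edge, which gives acyclicity and termination; the value is constant
    along the path followed on [x], so the sink reached carries the value of the source. *)
Lemma has_bp_semantics n (node : finType) (var : node -> 'I_n)
    (succ : node -> bool -> node + bool) (source : node + bool)
    (rank : node + bool -> nat) (value : assignment n -> node + bool -> bool) :
  (forall u c, rank (succ u c) < rank (inl u)) ->
  (forall x c, value x (inr c) = c) ->
  (forall x u, value x (succ u (x (var u))) = value x (inl u)) ->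
  has_bp [ffun x => value x source] #|node|.
Proof.
move=> rank_succ value_sink value_succ.
pose edge : rel node := fun u v => [exists c, succ u c == inl v].
have rank_edge u v : edge u v -> rank (inl v) < rank (inl u).
  by move=> /existsP[c /eqP <-]; exact: rank_succ.
have rank_connect u v : connect edge u v -> rank (inl v) <= rank (inl u).
  move=> /connectP[s]; elim: s u => [|w s IHs] u /=; first by move=> _ ->.
  by move=> /andP[/rank_edge uw ws] /(IHs _ ws) /leq_trans; apply; exact: ltnW.
have acyclic u v : edge u v -> ~~ connect edge v u.
  by move=> /rank_edge uv; apply/negP => /rank_connect; rewrite leqNgt uv.
pose B := @BranchingProgram n node var succ source acyclic.
exists B; split=> // x; rewrite ffunE.
suff: forall w : bp_node B + bool, fconnect (@bp_step n B x) w (inr (value x w)).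
  exact.
move=> w; have [r] := ubnP (rank w); elim: r w => // r IHr [u|c] ru.
  rewrite -value_succ; apply: connect_trans (connect1 _) (IHr _ _).
    exact/eqP.
  exact: leq_trans (rank_succ _ _) ru.
by rewrite value_sink connect0.
Qed.

(** * Sequential search *)

Section Scan.
Variables (n : nat) (A : Type) (test value : 'I_n -> bool) (default : bool).

(** Indices are tried downwards from $i - 1$, so $i = 0$ means that the search has failed; [insub]
    fails only beyond the range. *)
Fixpoint scan (i : nat) : bool :=
  if i is j.+1 then
    if insub j is Some o then if test o then value o else scan j else default
  else default.

Definition jump (node : 'I_n -> A) (exit : A) (i : nat) : A :=
  if i is j.+1 then if insub j is Some o then node o else exit else exit.

Lemma scanS (o : 'I_n) : scan o.+1 = if test o then value o else scan o.
Proof. by rewrite /= valK. Qed.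

Lemma jump_scan (eval : A -> bool) node exit :
  eval exit = default -> (forall o : 'I_n, eval (node o) = scan o.+1) ->
  forall i, eval (jump node exit i) = scan i.
Proof.
move=> Eexit Enode [|j] //; rewrite /jump.
by case: insubP => [ o _ <-|jn]; rewrite ?Enode //= insubF // (negPf jn).
Qed.

Lemma jump_rank (rank : A -> nat) (bound : nat -> nat) node exit :
  (forall i, rank exit <= bound i) -> (forall o : 'I_n, rank (node o) <= bound o.+1) ->
  forall i, rank (jump node exit i) <= bound i.
Proof.
move=> Eexit Enode [|j] //; rewrite /jump.
by case: insubP => [ o _ <-|_]; rewrite ?Enode ?Eexit.
Qed.

Lemma scan_none i : (forall o, ~~ test o) -> scan i = default.
Proof.
move=> test0; elim: i => //= j IHj; case: insub => // o.
by rewrite (negPf (test0 o)).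
Qed.

(** Only the values must agree, not the indices: a wrong guess may have several mismatches, all with
    value [false]. *)
Lemma scan_some o : test o -> (forall o', test o' -> value o' = value o) ->
  scan n = value o.
Proof.
move=> testo valueC.
suff scan_le i : i <= n -> o < i -> scan i = value o by exact: scan_le.
elim: i => // i IHi ltin oi.
rewrite -[i]/(val (Ordinal ltin)) scanS; case: ifPn => [/valueC //|ntest].
apply: IHi; first exact: ltnW.
move: oi; rewrite ltnS leq_eqVlt => /orP[/eqP Eo|//].
have Eo' : o = Ordinal ltin by exact: val_inj.
by rewrite -Eo' testo in ntest.
Qed.

End Scan.

(** * A branching program for indirect storage access *)

(* Rows, columns and the selected block are encoded in unary (the true variable
   of largest index wins), so that finding one takes a vertex per possible value. *)
Section StorageAccess.
Variables (p a K L N : nat).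

Notation guess := {ffun 'I_a -> bool}.
Notation cell := (guess * 'I_K * 'I_L)%type.
(* The variables read independently of the block: the guess and the table. *)
Notation shared := ('I_a + cell)%type.
Notation content := {ffun 'I_L -> bool}.

Variables (vsel : 'I_p -> 'I_N) (vaddr : 'I_p -> 'I_a -> 'I_N).
Variables (vrow : 'I_p -> 'I_K -> 'I_N) (vcol : 'I_p -> 'I_L -> 'I_N).
Variable vshared : shared -> 'I_N.

Definition row_content (k : 'I_K) (m : {ffun shared -> bool}) : content :=
  [ffun l => m (inr ([ffun j => m (inl j)], k, l))].

Definition col_value (x : assignment N) (c : content) (s : 'I_p) : bool :=
  scan (fun l => x (vcol s l)) c false L.

Definition content_value (x : assignment N) (c : content) : bool :=
  scan (fun s => x (vsel s)) (col_value x c) false p.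

Definition row_value (x : assignment N) (k : 'I_K) : bool :=
  content_value x (row_content k [ffun v => x (vshared v)]).

Definition addr_value (x : assignment N) (s : 'I_p) : bool :=
  scan (fun k => x (vrow s k)) (row_value x) false K.

(** The test looks for a mismatch, which rejects; the default, reached when all bits agree, goes on
    to the row. *)
Definition sel_value (x : assignment N) (s : 'I_p) : bool :=
  scan (fun j => x (vshared (inl j)) != x (vaddr s j)) (fun=> false)
    (addr_value x s) a.

Definition isa_value (x : assignment N) : bool :=
  scan (fun s => x (vsel s)) (sel_value x) false p.

(** The summands are the phases in order. In the second, [None] reads a guessed bit and [Some e]
    compares it with the address. The fourth has forgotten the block, so its size is free of [p];
    this is why the fifth looks for the block again. *)
Notation node := ('I_p + 'I_p * 'I_a * option bool + 'I_p * 'I_K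
  + 'I_K * {ffun shared -> bool} * 'I_#|{: shared}| + content * 'I_p
  + content * 'I_p * 'I_L)%type.
Notation vertex := (node + bool)%type.

Definition sel_node s : vertex := inl (inl (inl (inl (inl (inl s))))).
Definition addr_node s o j : vertex := inl (inl (inl (inl (inl (inr (s, j, o)))))).
Definition row_node s k : vertex := inl (inl (inl (inl (inr (s, k))))).
Definition shared_node k m i : vertex := inl (inl (inl (inr (k, m, i)))).
Definition resel_node c s : vertex := inl (inl (inr (c, s))).
Definition col_node c s l : vertex := inl (inr (c, s, l)).

(* [goto_x i] leads to the vertex of index [i - 1] of its phase, or out of the
   phase if [i = 0]. *)
Definition goto_col c s := jump (col_node c s) (inr false).
Definition goto_resel c := jump (resel_node c) (inr false).
Definition goto_shared k m :=
  jump (shared_node k m) (goto_resel (row_content k m) p).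
Definition goto_row s := jump (row_node s) (inr false).
Definition goto_addr s := jump (addr_node s None) (goto_row s K).
Definition goto_sel := jump sel_node (inr false).

Definition isa_var (u : node) : 'I_N :=
  match u with
  | inl (inl (inl (inl (inl s)))) => vsel s
  | inl (inl (inl (inl (inr (s, j, o))))) => if o then vaddr s j else vshared (inl j)
  | inl (inl (inl (inr (s, k)))) => vrow s k
  | inl (inl (inr (k, m, i))) => vshared (enum_val i)
  | inl (inr (c, s)) => vsel s
  | inr (c, s, l) => vcol s l
  end.

Definition isa_succ (u : node) (e : bool) : vertex :=
  match u with
  | inl (inl (inl (inl (inl s)))) => if e then goto_addr s a else goto_sel s
  | inl (inl (inl (inl (inr (s, j, None))))) => addr_node s (Some e) j
  | inl (inl (inl (inl (inr (s, j, Some e'))))) =>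
      if e' != e then inr false else goto_addr s j
  | inl (inl (inl (inr (s, k)))) =>
      if e then goto_shared k [ffun=> false] #|{: shared}| else goto_row s k
  | inl (inl (inr (k, m, i))) =>
      goto_shared k [ffun v => if v == enum_val i then e else m v] i
  | inl (inr (c, s)) => if e then goto_col c s L else goto_resel c s
  | inr (c, s, l) => if e then inr (c l) else goto_col c s l
  end.

(** Each phase is raised above all later ones; a guessed bit takes two steps, hence the doubling. *)
Definition isa_rank (u : vertex) : nat :=
  match u with
  | inl (inl (inl (inl (inl (inl s))))) =>
      L + p + #|{: shared}| + K + a.*2 + s.+1
  | inl (inl (inl (inl (inl (inr (s, j, o)))))) =>
      L + p + #|{: shared}| + K + (if o then j.*2.+1 else j.*2.+2)
  | inl (inl (inl (inl (inr (s, k))))) => L + p + #|{: shared}| + k.+1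
  | inl (inl (inl (inr (k, m, i)))) => L + p + i.+1
  | inl (inl (inr (c, s))) => L + s.+1
  | inl (inr (c, s, l)) => l.+1
  | inr _ => 0
  end.

(** The memory at the end of the reading phase, if it is now [m] and the variables of rank below [i]
    are still to be read. *)
Definition overwrite (x : assignment N) (m : {ffun shared -> bool}) (i : nat) :
    {ffun shared -> bool} :=
  [ffun v => if enum_rank v < i then x (vshared v) else m v].

Definition isa_eval (x : assignment N) (u : vertex) : bool :=
  match u with
  | inl (inl (inl (inl (inl (inl s))))) =>
      scan (fun s => x (vsel s)) (sel_value x) false s.+1
  | inl (inl (inl (inl (inl (inr (s, j, o)))))) =>
      let: e := if o is Some e then e else x (vshared (inl j)) in
      if e != x (vaddr s j) then false else
      scan (fun j => x (vshared (inl j)) != x (vaddr s j)) (fun=> false)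
        (addr_value x s) j
  | inl (inl (inl (inl (inr (s, k))))) =>
      scan (fun k => x (vrow s k)) (row_value x) false k.+1
  | inl (inl (inl (inr (k, m, i)))) =>
      content_value x (row_content k (overwrite x m i.+1))
  | inl (inl (inr (c, s))) => scan (fun s => x (vsel s)) (col_value x c) false s.+1
  | inl (inr (c, s, l)) => scan (fun l => x (vcol s l)) c false l.+1
  | inr e => e
  end.

Lemma rank_goto_col c s i : isa_rank (goto_col c s i) <= i.
Proof. exact: (@jump_rank _ _ isa_rank id). Qed.

Lemma rank_goto_resel c i : isa_rank (goto_resel c i) <= L + i.
Proof. exact: (@jump_rank _ _ isa_rank (addn L)). Qed.

Lemma rank_goto_shared k m i : isa_rank (goto_shared k m i) <= L + p + i.
Proof.
apply: (@jump_rank _ _ isa_rank (addn (L + p))) => // j.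
by apply: leq_trans (rank_goto_resel _ _) _; lia.
Qed.

Lemma rank_goto_row s i : isa_rank (goto_row s i) <= L + p + #|{: shared}| + i.
Proof. exact: (@jump_rank _ _ isa_rank (addn (L + p + #|{: shared}|))). Qed.

Lemma rank_goto_addr s i :
  isa_rank (goto_addr s i) <= L + p + #|{: shared}| + K + i.*2.
Proof.
apply: (@jump_rank _ _ isa_rank (fun i => L + p + #|{: shared}| + K + i.*2)) => // j.
by apply: leq_trans (rank_goto_row _ _) _; lia.
Qed.

Lemma rank_goto_sel i :
  isa_rank (goto_sel i) <= L + p + #|{: shared}| + K + a.*2 + i.
Proof. exact: (@jump_rank _ _ isa_rank (addn (L + p + #|{: shared}| + K + a.*2))). Qed.

Lemma eval_goto_col x c s i :
  isa_eval x (goto_col c s i) = scan (fun l => x (vcol s l)) c false i.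
Proof. exact: (@jump_scan _ _ _ _ _ (isa_eval x)). Qed.

Lemma eval_goto_resel x c i :
  isa_eval x (goto_resel c i) = scan (fun s => x (vsel s)) (col_value x c) false i.
Proof. exact: (@jump_scan _ _ _ _ _ (isa_eval x)). Qed.

Lemma eval_goto_shared x k m i : i <= #|{: shared}| ->
  isa_eval x (goto_shared k m i) = content_value x (row_content k (overwrite x m i)).
Proof.
case: i => [_|i lti]; rewrite /goto_shared /jump.
  rewrite eval_goto_resel; congr (content_value x (row_content k _)).
  by apply/ffunP => v; rewrite ffunE ltn0.
by rewrite -[i]/(val (Ordinal lti)) valK.
Qed.

Lemma eval_goto_row x s i :
  isa_eval x (goto_row s i) = scan (fun k => x (vrow s k)) (row_value x) false i.
Proof. exact: (@jump_scan _ _ _ _ _ (isa_eval x)). Qed.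

Lemma eval_goto_addr x s i :
  isa_eval x (goto_addr s i) =
  scan (fun j => x (vshared (inl j)) != x (vaddr s j)) (fun=> false)
    (addr_value x s) i.
Proof.
apply: (@jump_scan _ _ _ _ _ (isa_eval x)) => [|j]; first exact: eval_goto_row.
by rewrite scanS.
Qed.

Lemma eval_goto_sel x i :
  isa_eval x (goto_sel i) = scan (fun s => x (vsel s)) (sel_value x) false i.
Proof. exact: (@jump_scan _ _ _ _ _ (isa_eval x)). Qed.

Lemma isa_rank_succ u e : isa_rank (isa_succ u e) < isa_rank (inl u).
Proof.
case: u => [[[[[s|[[s j] [e'|]]]|[s k]]|[[k m] i]]|[c s]]|[[c s] l]] /=.
- case: e; last by have := rank_goto_sel s; lia.
  by have := rank_goto_addr s a; lia.
- by have := rank_goto_addr s j; case: ifP => /= _; lia.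
- by lia.
- case: e; last by have := rank_goto_row s k; lia.
  by rewrite addnS ltnS (leq_trans (rank_goto_shared _ _ _)) ?leq_addr.
- by rewrite addnS ltnS; exact: rank_goto_shared.
- case: e; last by have := rank_goto_resel c s; lia.
  by have := rank_goto_col c s L; lia.
- by case: e => //=; have := rank_goto_col c s l; lia.
Qed.

Lemma isa_eval_succ x u : isa_eval x (isa_succ u (x (isa_var u))) = isa_eval x (inl u).
Proof.
case: u => [[[[[s|[[s j] [e'|]]]|[s k]]|[[k m] i]]|[c s]]|[[c s] l]].
- by rewrite [RHS]scanS /=; case: ifP; rewrite ?eval_goto_addr ?eval_goto_sel.
- by rewrite /=; case: ifP => //; rewrite eval_goto_addr.
- by [].
- rewrite [RHS]scanS /=; case: ifP => _; rewrite ?eval_goto_row //.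
  (* Reading all shared variables overwrites the whole initial memory. *)
  rewrite eval_goto_shared //; congr (content_value x (row_content k _)).
  by apply/ffunP => v; rewrite !ffunE ltn_ord.
- rewrite /= eval_goto_shared; last by rewrite ltnW.
  congr (content_value x (row_content k _)); apply/ffunP => v; rewrite !ffunE.
  rewrite ltnS; have [->|nv] := eqVneq v (enum_val i).
    by rewrite enum_valK ltnn leqnn.
  suff ->: (enum_rank v <= i) = (enum_rank v < i) by [].
  rewrite leq_eqVlt; case: eqP => //= ri.
  by rewrite -(enum_rankK v) (val_inj ri) eqxx in nv.
- by rewrite [RHS]scanS /=; case: ifP; rewrite ?eval_goto_col ?eval_goto_resel.
- by rewrite [RHS]scanS /=; case: ifP; rewrite ?eval_goto_col.
Qed.

Lemma isa_value_bp :
  has_bp [ffun x => isa_value x]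
    (p * (1 + 3 * a + K + 2 ^ L * (1 + L)) + K * 2 ^ #|{: shared}| * #|{: shared}|).
Proof.
have -> : p * (1 + 3 * a + K + 2 ^ L * (1 + L)) + K * 2 ^ #|{: shared}| * #|{: shared}|
    = #|{: node}|.
  rewrite !(card_sum, card_prod, card_option, card_ffun, card_ord, card_bool); lia.
have -> : [ffun x => isa_value x] = [ffun x => isa_eval x (goto_sel p)].
  by apply/ffunP => x; rewrite !ffunE eval_goto_sel.
exact: (has_bp_semantics _ isa_rank_succ _ isa_eval_succ).
Qed.

End StorageAccess.

(** * Indirect storage access with guessed bits, and its subfunctions *)

Section NeciporukBound.
Variables (d p a K L : nat).
Hypothesis le_ad : a <= d.

Notation cell := ({ffun 'I_a -> bool} * 'I_K * 'I_L)%type.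
(** [None] selects the block; the other variables hold its address: bits, row and column. *)
Notation block_var := (option ('I_a + 'I_K + 'I_L)).
Notation var := ('I_p * block_var + cell)%type.
Notation n := #|{: var}|.

Definition isa_input (v : var) : 'I_(n + d) := lshift d (enum_rank v).

Definition isa_cell (v : 'I_a + cell) : 'I_(n + d) :=
  match v with
  | inl j => rshift n (widen_ord le_ad j)
  | inr t => isa_input (inr t)
  end.

Definition guessed_isa : assignment (n + d) -> bool :=
  isa_value (fun s => isa_input (inl (s, None)))
    (fun s j => isa_input (inl (s, Some (inl (inl j)))))
    (fun s k => isa_input (inl (s, Some (inl (inr k)))))
    (fun s l => isa_input (inl (s, Some (inr l)))) isa_cell.

Definition isa : boolfun n :=
  [ffun x => [exists b : assignment d, guessed_isa (cat_assignment x b)]].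

Lemma LNBP_isa :
  LNBP d isa <= p * (1 + 3 * a + K + 2 ^ L * (1 + L))
    + K * 2 ^ #|{: 'I_a + cell}| * #|{: 'I_a + cell}|.
Proof.
rewrite /LNBP; case: ex_minnP => s _; apply; apply/asboolP.
exists [ffun x => guessed_isa x]; split; last exact: isa_value_bp.
by move=> x; rewrite ffunE; apply: eq_existsb => b; rewrite ffunE.
Qed.

Definition query_block (t : cell) (w : block_var) : bool :=
  match w with
  | None => true
  | Some (inl (inl j)) => t.1.1 j
  | Some (inl (inr k)) => k == t.1.2
  | Some (inr l) => l == t.2
  end.

(** The table lies outside block [s] and the address inside, so these inputs tell the subfunctions
    on the block apart. *)
Definition query (s : 'I_p) (h : {ffun cell -> bool}) (t : cell) : assignment n :=
  [ffun i => match enum_val i with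
             | inl (s', w) => (s' == s) && query_block t w
             | inr t' => h t'
             end].

Lemma cat_query_block s h t (b : assignment d) s' w :
  cat_assignment (query s h t) b (isa_input (inl (s', w))) =
  (s' == s) && query_block t w.
Proof. by rewrite ffunE (unsplitK (inl _)) ffunE enum_rankK. Qed.

Lemma cat_query_cell s h t (b : assignment d) t' :
  cat_assignment (query s h t) b (isa_cell (inr t')) = h t'.
Proof. by rewrite ffunE (unsplitK (inl _)) ffunE enum_rankK. Qed.

Lemma cat_query_guess s h t (b : assignment d) j :
  cat_assignment (query s h t) b (isa_cell (inl j)) = b (widen_ord le_ad j).
Proof. by rewrite ffunE (unsplitK (inr _)). Qed.

Lemma guessed_isa_query s h t (b : assignment d) :
  guessed_isa (cat_assignment (query s h t) b) =
  [forall j, b (widen_ord le_ad j) == t.1.1 j] && h t.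
Proof.
have sel_unique (v : 'I_p -> bool) :
    scan (fun s' => cat_assignment (query s h t) b (isa_input (inl (s', None))))
      v false p = v s.
  apply: scan_some => [|s']; first by rewrite cat_query_block eqxx.
  by rewrite cat_query_block andbT => /eqP->.
rewrite /guessed_isa /isa_value sel_unique /sel_value.
case: forallP => [agree|disagree] /=; last first.
  have /existsP[j bj] : [exists j, b (widen_ord le_ad j) != t.1.1 j].
    by rewrite -negb_forall; apply/forallP.
  by rewrite (@scan_some _ _ _ _ j) // cat_query_guess cat_query_block eqxx.
rewrite scan_none => [|j]; last first.
  by rewrite cat_query_guess cat_query_block eqxx (eqP (agree j)) eqxx.
rewrite /addr_value (@scan_some _ _ _ _ t.1.2); first last.
- by move=> k; rewrite cat_query_block eqxx => /eqP->.
- by rewrite cat_query_block /= !eqxx.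
rewrite /row_value /content_value sel_unique /col_value.
rewrite (@scan_some _ _ _ _ t.2); first last.
- by move=> l; rewrite cat_query_block eqxx => /eqP->.
- by rewrite cat_query_block /= !eqxx.
rewrite [LHS]ffunE [LHS]ffunE cat_query_cell; congr (h _).
case: t agree {sel_unique} => [[g k] l] /= agree; congr (_, _, _).
by apply/ffunP => j; rewrite [LHS]ffunE [LHS]ffunE cat_query_guess; apply/eqP.
Qed.

Lemma isa_query s h t : isa (query s h t) = h t.
Proof.
rewrite ffunE; apply/existsP/idP => [[b]|ht].
  by rewrite guessed_isa_query => /andP[].
(* The right guess: the address bits of [t], padded with [false] to length [d]. *)
exists [ffun i : 'I_d => if insub (val i) is Some j then t.1.1 j else false].
rewrite guessed_isa_query ht andbT; apply/forallP => j.
by rewrite ffunE /= valK.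
Qed.

(** The blocks are fibres of a colouring, whose fibres form a partition; the colour [None] is the
    table. *)
Definition isa_color (i : 'I_n) : option 'I_p :=
  if enum_val i is inl (s, _) then Some s else None.

Definition isa_block (s : 'I_p) : {set 'I_n} := [set i | isa_color i == Some s].

(** With the table fixed to [h], the subfunction takes the entries of [h] as values at the
    addresses, so distinct tables give distinct subfunctions. *)
Lemma nb_subfun_isa s : 2 ^ (2 ^ a * K * L) <= nb_subfun (isa_block s) isa.
Proof.
have -> : 2 ^ (2 ^ a * K * L) = #|{: {ffun cell -> bool}}|.
  by rewrite !(card_prod, card_ffun, card_ord, card_bool).
pose table (h : {ffun cell -> bool}) : assignment n :=
  [ffun i => if enum_val i is inr t then h t else false].
pose block_query t : {ffun {i : 'I_n | i \in isa_block s} -> bool} :=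
  [ffun j => if enum_val (val j) is inl (_, w) then query_block t w else false].
have subfunE (h : {ffun cell -> bool}) t :
    subfun isa (isa_block s) (table h) (block_query t) = h t.
  rewrite ffunE -(isa_query s h t); congr (isa _); apply/ffunP => i; rewrite !ffunE.
  case: insubP => [ j | ]; rewrite inE /isa_color.
    move=> si ji; rewrite ffunE ji; case: (enum_val i) si => [[s' w]|//].
    by move=> /eqP[->]; rewrite eqxx.
  by case: (enum_val i) => [[s' w]|//]; rewrite (inj_eq Some_inj) => /negPf->.
rewrite -(card_image
  (f := fun h : {ffun cell -> bool} => subfun isa (isa_block s) (table h))).
  apply: subset_leq_card; apply/fintype.subsetP => _ /mapP[h _ ->]; exact: imset_f.
by move=> h h' /ffunP Eh; apply/ffunP => t; rewrite -!subfunE Eh.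
Qed.

Lemma neciporuk_isa (b : nat -> nat) : neciporuk_fun (LNBP d) b ->
  p * b (2 ^ (2 ^ a * K * L)) <= p * (1 + 3 * a + K + 2 ^ L * (1 + L))
    + K * 2 ^ #|{: 'I_a + cell}| * #|{: 'I_a + cell}|.
Proof.
move=> [b_mono b_sum].
apply: leq_trans LNBP_isa.
apply: leq_trans (b_sum n isa _ (preim_partitionP isa_color [set: 'I_n]%SET)).
have isa_block_inj : injective isa_block.
  move=> s s' /setP /(_ (enum_rank (inl (s, None)))).
  by rewrite !inE /isa_color enum_rankK eqxx (inj_eq Some_inj) => /esym/eqP.
rewrite /neciporuk_sum (big_setID (isa_block @: [set: 'I_p])) /=.
rewrite (setIidPr _); last first.
  apply/fintype.subsetP => _ /imsetP[s _ ->]; apply/imsetP.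
  exists (enum_rank (inl (s, None))) => //.
  by apply/setP => i; rewrite !inE /isa_color enum_rankK eq_sym.
rewrite big_imset /=; last by move=> s s' _ _; exact: isa_block_inj.
(* Any class left over, that is the table, is dropped. *)
apply: leq_trans (leq_addr _ _).
rewrite -[p in p * _]card_ord -cardsT -sum_nat_const; apply: leq_sum => s _.
by apply: b_mono; [rewrite expn_gt0 | exact: nb_subfun_isa].
Qed.

End NeciporukBound.

(** * Upper bounds on Neciporuk functions *)

Lemma neciporuk_fun_le (d a K L : nat) (b : nat -> nat) :
  neciporuk_fun (LNBP d) b -> a <= d ->
  b (2 ^ (2 ^ a * K * L)) <= 1 + 3 * a + K + 2 ^ L * (1 + L).
Proof.
(* With [p > Q] blocks, the shared cost [Q] is less than one unit per block. *)
move=> bP le_ad; set Q := K * 2 ^ #|{: 'I_a + {ffun 'I_a -> bool} * 'I_K * 'I_L}|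
  * #|{: 'I_a + {ffun 'I_a -> bool} * 'I_K * 'I_L}|.
have := neciporuk_isa Q.+1 K L le_ad bP; rewrite -/Q.
rewrite leqNgt [in X in _ -> X]leqNgt; apply: contra => lt_b.
apply: (@leq_trans (Q.+1 * (1 + 3 * a + K + 2 ^ L * (1 + L)).+1)).
  by rewrite mulnS addnC ltn_add2r.
by rewrite leq_mul2l lt_b.
Qed.

(** * The contribution of one block of a partition *)

Lemma nb_subfun_gt0 n (f : boolfun n) (V : {set 'I_n}) : 0 < nb_subfun V f.
Proof.
by rewrite card_gt0; apply/set0Pn; exists (subfun f V [ffun=> false]); exact: imset_f.
Qed.

Lemma nb_subfun_le_block n (f : boolfun n) (V : {set 'I_n}) :
  nb_subfun V f <= 2 ^ (2 ^ #|V|).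
Proof. by apply: leq_trans (max_card _) _; rewrite !card_ffun card_bool card_sig. Qed.

Lemma nb_subfun_le_arity n (f : boolfun n) (V : {set 'I_n}) : nb_subfun V f <= 2 ^ n.
Proof. by apply: leq_trans (leq_imset_card _ _) _; rewrite card_ffun card_bool card_ord. Qed.

Lemma sqrS_le_expn2 k : k.+1 ^ 2 <= 4 * 2 ^ k.
Proof.
(* Squares at most double from 3 on; the smaller cases are computed. *)
elim: k => [|[|[|k]] IHk] //.
have : k.+4 ^ 2 <= 2 * k.+3 ^ 2 by lia.
by rewrite [2 ^ _]expnS; move: IHk; lia.
Qed.

Section BlockBound.
Variables (d n : nat) (b : nat -> nat) (f : boolfun n) (V : {set 'I_n}).
Hypothesis bP : neciporuk_fun (LNBP d) b.
Hypothesis V_gt0 : 0 < #|V|.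

Lemma neciporuk_block_le a K L : a <= d ->
  (2 ^ #|V| <= 2 ^ a * K * L) || (n <= 2 ^ a * K * L) ->
  b (nb_subfun V f) <= 1 + 3 * a + K + 2 ^ L * (1 + L).
Proof.
move=> le_ad le_aKL; apply: leq_trans (neciporuk_fun_le K L bP le_ad).
have [b_mono _] := bP; apply: b_mono; first exact: nb_subfun_gt0.
case/orP: le_aKL => le_aKL.
  by apply: leq_trans (nb_subfun_le_block f V) _; rewrite leq_exp2l.
by apply: leq_trans (nb_subfun_le_arity f V) _; rewrite leq_exp2l.
Qed.

(** The whole address is guessed: $a = |V|$ and $K = L = 1$ cost $3|V| + 6$. *)
Lemma neciporuk_small_block : #|V| <= d -> b (nb_subfun V f) <= 9 * #|V|.
Proof.
move=> le_Vd; have := @neciporuk_block_le #|V| 1 1 le_Vd.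
rewrite !muln1 leqnn => /(_ isT).
by lia.
Qed.

(** If $|V| > d$, then $a = d$, $K = 2$, $L = 1$ give $2^{d+1} > n$ cells at cost $3d + 7$. *)
Lemma neciporuk_block_small_arity : n < 2 ^ d.+1 -> b (nb_subfun V f) <= 9 * #|V|.
Proof.
move=> lt_n; have [/neciporuk_small_block //|lt_dV] := leqP #|V| d.
have := @neciporuk_block_le d 2 1 (leqnn d).
rewrite muln1 -expnSr (ltnW lt_n) orbT => /(_ isT).
by lia.
Qed.

(** Here $\lambda + 1$ stands for $\log_2 n$ and denominators are cleared. Taking $a = d$, $K =
    2^{|V|-d}$, $L = 1$, the term $K$ is harmless: $2^{|V|} \le 2^h$ with $h = \lfloor \lambda/2
    \rfloor$, and the logarithmic factors are at most $16 \cdot 2^h$, while $2^{2h} \le n$. *)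
Lemma neciporuk_block_medium lam : 2 ^ lam <= n ->
  d < #|V| -> 2 * #|V| <= lam ->
  b (nb_subfun V f) * (2 ^ d * (lam.+1 - d) * lam.+1)
    <= (9 * (2 ^ d * (lam.+1 - d) * lam.+1) + 160 * n) * #|V|.
Proof.
move=> le_lam lt_dV le_V.
have := @neciporuk_block_le d (2 ^ (#|V| - d)) 1 (leqnn d).
rewrite muln1 -expnD (subnKC (ltnW lt_dV)) leqnn => /(_ isT) b_le.
set W := 2 ^ d * _ * _.
have b_le' : b (nb_subfun V f) <= 9 * #|V| + 2 ^ (#|V| - d) by lia.
apply: leq_trans (leq_mul b_le' (leqnn W)) _.
rewrite (mulnDl (9 * _)) (mulnDl (9 * W)) mulnAC leq_add2l.
rewrite /W !mulnA -expnD (subnK (ltnW lt_dV)).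
apply: (@leq_trans (160 * n)); last by rewrite leq_pmulr.
pose h := lam./2.
have lamE : lam <= h.*2.+1 by rewrite /h; lia.
have hE : h.*2 <= lam by rewrite /h; lia.
have sq : (lam.+1 - d) * lam.+1 <= 16 * 2 ^ h.
  have : (lam.+1 - d) * lam.+1 <= (2 * h.+1) * (2 * h.+1) by apply: leq_mul; lia.
  by have := sqrS_le_expn2 h; rewrite !expnS expn0; lia.
rewrite -mulnA; apply: leq_trans (leq_mul _ sq) _.
  by apply: (@leq_trans (2 ^ h)); [rewrite leq_exp2l // /h; lia | exact: leqnn].
have : 2 ^ h * 2 ^ h <= n.
  by rewrite -expnD addnn; apply: leq_trans le_lam; rewrite leq_exp2l.
by lia.
Qed.

(** With $L = \lceil m/4 \rceil$, the cost $2^L(1+L)$ of keeping a row is at most of the order of $K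
    \approx 2^m/L$, so $mX = O(2^m)$, where $2^d 2^m = 2^{\lambda+1} \le 2n$. *)
Lemma neciporuk_block_large lam : 2 ^ lam <= n < 2 ^ lam.+1 ->
  d < lam -> lam < 2 * #|V| ->
  b (nb_subfun V f) * (2 ^ d * (lam.+1 - d) * lam.+1)
    <= (9 * (2 ^ d * (lam.+1 - d) * lam.+1) + 160 * n) * #|V|.
Proof.
move=> /andP[le_lam lt_lam] lt_dlam le_V.
pose m := lam.+1 - d; pose L := (m + 3) %/ 4; pose K := (2 ^ m %/ L).+1.
have m_gt0 : 0 < m by rewrite /m; lia.
have L_gt0 : 0 < L by rewrite /L; lia.
have le_KL : 2 ^ m <= K * L by rewrite ltnW // ltn_ceil.
have le_KL' : K * L <= 2 ^ m + L by rewrite /K mulSn addnC leq_add2r leq_trunc_div.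
have := @neciporuk_block_le d K L (leqnn d) .
rewrite (_ : n <= 2 ^ d * K * L) ?orbT; last first.
  apply: leq_trans (ltnW lt_lam) _.
  rewrite -(subnKC (_ : d <= lam.+1)); last by lia.
  by rewrite expnD -mulnA leq_mul2l le_KL orbT.
move=> /(_ isT) b_le; set X := K + 2 ^ L * (1 + L).
have mX : m * X <= 40 * 2 ^ m.
  have m_le : m <= 4 * L by rewrite /L; lia.
  have L_lt : L < 2 ^ L by exact: ltn_expl.
  have L_le : 2 ^ L <= 2 ^ m by rewrite leq_exp2l // /L; lia.
  (* Rounding up gives $3L \le m + 3$, whence the factor $8 = 2^3$. *)
  have e3 : 2 ^ L * 2 ^ L * 2 ^ L <= 8 * 2 ^ m.
    by rewrite -(expnD 2 3 m) -!expnD leq_exp2l // /L; lia.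
  rewrite /X mulnDr; have mK : m * K <= 8 * 2 ^ m.
    by apply: leq_trans (leq_mul m_le (leqnn K)) _; lia.
  have : m * (2 ^ L * (1 + L)) <= (4 * 2 ^ L) * (2 ^ L * 2 ^ L).
    by apply: leq_mul; [lia | apply: leq_mul; lia].
  by lia.
have b_le' : b (nb_subfun V f) <= 9 * #|V| + X by rewrite /X; lia.
rewrite -/m; set W := 2 ^ d * _ * _.
apply: leq_trans (leq_mul b_le' (leqnn W)) _.
rewrite (mulnDl (9 * _)) (mulnDl (9 * W)) mulnAC leq_add2l.
have dm : 2 ^ d * 2 ^ m <= 2 * n.
  by rewrite -expnD /m subnKC ?expnS; lia.
have -> : X * W = 2 ^ d * (m * X) * lam.+1 by rewrite /W; lia.
(* One logarithmic factor is absorbed by the block: $\lambda + 1 \le 2|V|$. This fixes the constant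
   160. *)
apply: (@leq_trans (80 * n * (2 * #|V|))); last by lia.
apply: leq_mul => //; apply: leq_trans (leq_mul (leqnn _) mX) _; lia.
Qed.

End BlockBound.

(** * Summation over the blocks *)

Lemma sum_card_partition n (P : {set {set 'I_n}}) :
  partition P [set: 'I_n]%SET -> \sum_(V in P) #|V| = n.
Proof. by move=> /card_partition; rewrite cardsT card_ord. Qed.

Lemma partition_block_gt0 n (P : {set {set 'I_n}}) V :
  partition P [set: 'I_n]%SET -> V \in P -> 0 < #|V|.
Proof.
by move=> /and3P[_ _ P0] VP; rewrite card_gt0; apply: contraNneq P0 => <-.
Qed.

Lemma neciporuk_sum_small_arity d n (b : nat -> nat) (f : boolfun n) P :
  neciporuk_fun (LNBP d) b -> partition P [set: 'I_n]%SET -> n < 2 ^ d.+1 ->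
  neciporuk_sum b f P <= 9 * n.
Proof.
move=> bP partP lt_n; rewrite -[in leqRHS](sum_card_partition partP) big_distrr.
apply: leq_sum => V VP; apply: neciporuk_block_small_arity bP _ lt_n.
exact: partition_block_gt0 partP VP.
Qed.

Lemma neciporuk_sum_large_arity d n (b : nat -> nat) (f : boolfun n) P lam :
  neciporuk_fun (LNBP d) b -> partition P [set: 'I_n]%SET ->
  d < lam -> 2 ^ lam <= n < 2 ^ lam.+1 ->
  neciporuk_sum b f P * (2 ^ d * (lam.+1 - d) * lam.+1)
    <= (9 * (2 ^ d * (lam.+1 - d) * lam.+1) + 160 * n) * n.
Proof.
move=> bP partP lt_dlam lam_n; rewrite -[X in _ <= _ * X](sum_card_partition partP).
rewrite big_distrl big_distrr; apply: leq_sum => V VP /=.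
have V_gt0 := partition_block_gt0 partP VP.
have [le_Vlam|lt_lamV] := leqP (2 * #|V|) lam; last first.
  exact: neciporuk_block_large.
have [le_Vd|lt_dV] := leqP #|V| d; last first.
  by case/andP: lam_n => le_lam _; exact: neciporuk_block_medium.
apply: leq_trans (leq_mul (neciporuk_small_block f bP V_gt0 le_Vd) (leqnn _)) _.
by rewrite mulnAC leq_mul2r leq_addr orbT.
Qed.

(** * Deterministic programs and programs with no guessed bit *)

(** There is a single assignment of no variables, so the same program computes [f] once its
    variables are cast from [n + 0] to [n]. *)
Lemma LNBP0_ge_BP n (f : boolfun n) : BP f <= LNBP 0 f.
Proof.
rewrite /BP /LNBP; case: ex_minnP => s _; apply; case: ex_minnP => r + _.
move=> /asboolP[f' [f'E [B [Bf' Br]]]]; apply/asboolP.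
pose B' := @BranchingProgram n (bp_node B) (fun u => cast_ord (addn0 n) (bp_var u))
  (@bp_succ _ B) (bp_source B) (@bp_acyclic _ B).
exists B'; split=> // x.
pose b0 : assignment 0 := [ffun=> false].
have -> : f x = f' (cat_assignment x b0).
  rewrite f'E; apply/existsP/idP => [[b]|]; last by exists b0.
  by rewrite (_ : b = b0) //; apply/ffunP => -[].
rewrite (eq_fconnect (f' := bp_step (cat_assignment x b0))); first exact: Bf'.
case=> [u|//] /=; congr (bp_succ _ _); rewrite ffunE.
case: split_ordP => j -> //; last by case: j.
by congr (x _); exact: val_inj.
Qed.

Lemma neciporuk_fun_BP b : neciporuk_fun BP b -> neciporuk_fun (LNBP 0) b.
Proof.
move=> [b_mono b_sum]; split=> // n f P /(b_sum n f P) /leq_trans.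
by apply; exact: LNBP0_ge_BP.
Qed.

(** * Comparison with Gamma *)

Import Order.TTheory GRing.Theory Num.Theory.
Local Open Scope classical_set_scope.
Local Open Scope ring_scope.

Lemma expn2_bounds_log2 (R : realType) (n k : nat) : (0 < n)%N ->
  (2 ^ k <= n < 2 ^ k.+1)%N -> k%:R <= log2 (n%:R : R) <= k.+1%:R.
Proof.
move=> n_gt0 /andP[le_n lt_n].
have ln2_gt0 : 0 < ln (2 : R) by rewrite ln_gt0 // ltr1n.
have ln_expn2 j : ln ((2 ^ j)%:R : R) = j%:R * ln 2.
  by rewrite natrX lnXn // mulr_natl.
have pos2 j : ((2 ^ j)%:R : R) \is Num.pos by rewrite posrE ltr0n expn_gt0.
have posn : (n%:R : R) \is Num.pos by rewrite posrE ltr0n.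
by rewrite /log2 ler_pdivlMr // ler_pdivrMr // -!ln_expn2 !ler_ln // !ler_nat le_n ltnW.
Qed.

Lemma trunc_log2_bounds n : (0 < n)%N ->
  (2 ^ trunc_log 2 n <= n < 2 ^ (trunc_log 2 n).+1)%N.
Proof. by move=> n_gt0; rewrite trunc_logP ?trunc_log_ltn. Qed.

Lemma Gamma_ge (R : realType) (x : R) d : x <= Gamma x d.
Proof. by rewrite /Gamma; case: ifP => // _; rewrite le_max lexx orbT. Qed.

(** The constant is $9 + 160$: the linear part and the fraction are each bounded by [Gamma]. *)
Lemma neciporuk_sum_le_Gamma (R : realType) d n (b : nat -> nat) (f : boolfun n) P :
  neciporuk_fun (LNBP d) b -> partition P [set: 'I_n]%SET ->
  (neciporuk_sum b f P)%:R <= 169 * Gamma (n%:R : R) d.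
Proof.
move=> bP partP.
have [lt_n|le_n] := ltnP n (2 ^ d.+1).
  apply: (@le_trans _ _ (9 * n%:R)).
    by rewrite -natrM ler_nat; exact: neciporuk_sum_small_arity bP partP lt_n.
  by apply: ler_pM => //; [rewrite ler_nat | exact: Gamma_ge].
have n_gt0 : (0 < n)%N by apply: leq_trans le_n; rewrite expn_gt0.
have := trunc_log2_bounds n_gt0; set lam := trunc_log 2 n => lam_n.
have lt_dlam : (d < lam)%N by exact: trunc_log_max.
have := neciporuk_sum_large_arity f bP partP lt_dlam lam_n.
set W := (2 ^ d * _ * _)%N; set S := neciporuk_sum b f P => SW.
have W_gt0 : (0 < W)%N by rewrite /W !muln_gt0 expn_gt0 subn_gt0 /= andbT ltnW.
have /andP[le_lam_log le_log] := expn2_bounds_log2 R n_gt0 lam_n.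
set l := log2 _ in le_lam_log le_log.
have lt_dl : d%:R < l by apply: lt_le_trans le_lam_log; rewrite ltr_nat.
have l_gt0 : 0 < l by apply: le_lt_trans lt_dl.
(* [W] uses $\lambda + 1 \ge \log_2 n$, so it dominates the denominator in [Gamma]. *)
have WR : 2 ^+ d * (l - d%:R) * l <= W%:R.
  rewrite /W !natrM natrX natrB; last by lia.
  apply: ler_pM; [ | exact: ltW | | exact: le_log].
    by rewrite mulr_ge0 ?exprn_ge0 // subr_ge0 ltW.
  by rewrite ler_wpM2l ?exprn_ge0 // lerD2r.
have S_le : S%:R <= 9 * n%:R + 160 * (n%:R ^+ 2 / W%:R) :> R.
  rewrite -(ler_pM2r (_ : 0 < W%:R :> R)) ?ltr0n // mulrDl -!mulrA mulVf ?mulr1.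
    by rewrite -!natrM -natrD ler_nat; lia.
  by rewrite pnatr_eq0 -lt0n.
have frac_le : n%:R ^+ 2 / W%:R <= n%:R ^+ 2 / (2 ^+ d * (l - d%:R) * l) :> R.
  rewrite ler_wpM2l ?exprn_ge0 // lef_pV2 // posrE ?ltr0n //.
  by rewrite mulr_gt0 // mulr_gt0 ?exprn_gt0 ?subr_gt0.
have Gamma_frac : n%:R ^+ 2 / (2 ^+ d * (l - d%:R) * l) <= Gamma (n%:R : R) d.
  have le_nR : 2 ^+ d.+1 <= n%:R :> R by rewrite -natrX ler_nat.
  by rewrite /Gamma le_nR le_max lexx.
have := Gamma_ge (n%:R : R) d; move: (Gamma _ _) Gamma_frac => G; move: S_le frac_le; lra.
Qed.

Lemma Gamma0_le (R : realType) n : (1 < n)%N ->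
  Gamma (n%:R : R) 0 <= 4 * (n%:R ^+ 2 / log2 (n%:R : R) ^+ 2).
Proof.
move=> n_gt1; have n_gt0 := ltnW n_gt1.
have := trunc_log2_bounds n_gt0; set lam := trunc_log 2 n => lam_n.
have lam_gt0 : (0 < lam)%N by exact: trunc_log_max.
have /andP[le_lam_log le_log] := expn2_bounds_log2 R n_gt0 lam_n.
rewrite /Gamma expr1 (ler_nat _ 2) n_gt1 expr0 mul1r subr0 -expr2.
set l := log2 _ in le_lam_log le_log *.
have l_gt0 : 0 < l by apply: lt_le_trans le_lam_log; rewrite ltr0n.
rewrite ge_max; apply/andP; split.
  by rewrite ler_peMl ?divr_ge0 ?exprn_ge0 ?ler1n // ltW.
(* The factor 4 lets $n^2/\log_2^2 n$ also cover the term $n$ of the maximum. *)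
have l_le : l ^+ 2 <= 4 * n%:R.
  apply: (@le_trans _ _ (lam.+1%:R ^+ 2)).
    by rewrite ler_pXn2r // nnegrE // ltW.
  rewrite -natrX -natrM ler_nat; apply: leq_trans (sqrS_le_expn2 lam) _.
  by case/andP: lam_n => le_n _; rewrite leq_mul2l.
by rewrite mulrA ler_pdivlMr ?exprn_gt0 // (expr2 n%:R) [leRHS]mulrCA ler_wpM2l.
Qed.

(** * The asymptotic bounds *)

Lemma neciporuk_bound_witness (M : complexity_measure) F n :
  exists b P, [/\ neciporuk_fun M b, partition P [set: 'I_n]%SET &
    neciporuk_bound M F n = neciporuk_sum b (F n) P].
Proof. by rewrite /neciporuk_bound; case: ex_maxnP => k /asboolP. Qed.

Theorem theorem7p4 (R : realType) (F : forall n : nat, boolfun n) :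
  (forall Delta : nat -> nat,
     (fun n : nat => (neciporuk_bound (LNBP (Delta n)) F n)%:R : R) =O_\oo
       (fun n : nat => Gamma (n%:R : R) (Delta n))) /\
  (fun n : nat => (neciporuk_bound BP F n)%:R : R) =O_\oo
    (fun n : nat => n%:R ^+ 2 / (log2 (n%:R : R)) ^+ 2).
Proof.
split=> [Delta|]; apply/eqO_exP.
  exists 169; first by rewrite ltr0n.
  near=> n; have [b [P [bP partP ->]]] := neciporuk_bound_witness (LNBP (Delta n)) F n.
  have Gamma_ge0 : 0 <= Gamma (n%:R : R) (Delta n) by apply: le_trans (Gamma_ge _ _).
  by rewrite normr_nat ger0_norm // neciporuk_sum_le_Gamma.
(* The case $d = 0$ of the bound by [Gamma], times the factor 4 from [Gamma0_le], which needs $n >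
   1$. *)
exists (169 * 4); first by rewrite mulr_gt0 ?ltr0n.
near=> n; have n_gt1 : (1 < n)%N by near: n; exact: nbhs_infty_gt.
have [b [P [bP partP ->]]] := neciporuk_bound_witness BP F n.
rewrite normr_nat ger0_norm; last by rewrite divr_ge0 ?sqr_ge0.
apply: le_trans (neciporuk_sum_le_Gamma R (F n) (neciporuk_fun_BP bP) partP) _.
by rewrite -mulrA ler_wpM2l // Gamma0_le.
Unshelve. all: by end_near.
Qed.
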